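(* Let $k\ge2$. Algorithm 1 run with sample size $pn=\frac{n}{e}$ and with $\mathcal{A}$ being the greedy algorithm is $$\frac{1+\frac{1}{2e^3}-\frac{3}{2e}-\frac{e-1}{e^2k}}{e-1}\left(1-\frac{\sqrt{k-1}}{(k+1)\sqrt{2\pi}}\right)\text{-competitive}$$ for the submodular secretary problem.
   Context: Submodular secretary setting. Let $U$ be a finite ground set of $n$ items and $k\ge1$ an integer. Let $v\colon 2^U\to\mathbb{R}_{\ge0}$ be monotone and submodular, and $\mathrm{OPT}\in\arg\max\{v(S): S\subseteq U, |S|\le k\}$. The items arrive one per round (rounds $1,\dots,n$) in a uniformly random order; $U^{\le \ell}$ denotes the set of items arriving in rounds $1,\dots,\ell$. The greedy algorithm, given $L\subseteq U$, starts from $\emptyset$ and repeatedly adds an item of $L$ with maximum marginal increase $v(S\cup\{x\})-v(S)$ (ties broken by a fixed rule depending only on the items) until $\min(k,|L|)$ items are chosen; $\mathcal{A}(L)$ denotes its output. Algorithm 1 with sample size $pn$: it rejects the items arriving in rounds $1,\dots,\lceil pn\rceil-1$; in each round $\ell\ge\lceil pn\rceil$, with arriving item $j$, it computes $S^{(\ell)}=\mathcal{A}(U^{\le\ell})$; if $j\in S^{(\ell)}$ and fewer than $k$ items have been accepted so far, $j$ is accepted, otherwise rejected. $\mathrm{ALG}$ denotes the set of accepted items. An algorithm is $c$-competitive if for every such $v$, $\mathbb{E}[v(\mathrm{ALG})]\ge (c-o(1))\,v(\mathrm{OPT})$, with $o(1)\to0$ as $n\to\infty$. *)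

(* Defs.v *)
From mathcomp Require Import all_boot all_fingroup.
From Stdlib Require Import Reals.
Set Implicit Arguments. Unset Strict Implicit. Unset Printing Implicit Defensive.

Local Open Scope R_scope.

(* ceiling of a real number, as a natural number (0 for negative inputs) *)
Definition Rceil_nat (x : R) : nat :=
  if Req_EM_T (IZR (up x) - 1) x then Z.to_nat (up x - 1) else Z.to_nat (up x).

Section Secretary.
Variable n : nat.
Notation U := 'I_n.

Definition nonneg_fn (v : {set U} -> R) := forall A, 0 <= v A.
Definition monotone_fn (v : {set U} -> R) :=
  forall A B : {set U}, A \subset B -> v A <= v B.
Definition submodular_fn (v : {set U} -> R) :=
  forall A B : {set U}, v (A :|: B) + v (A :&: B) <= v A + v B.

Definition is_opt (v : {set U} -> R) (k : nat) (O : {set U}) :=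
  (#|O| <= k)%nat /\ forall S : {set U}, (#|S| <= k)%nat -> v S <= v O.

Definition gain (v : {set U} -> R) (S : {set U}) (x : U) := v (x |: S) - v S.

(* item of L \ S with maximum marginal gain; ties broken by smallest index
   (enum 'I_n is increasing, and only a strictly larger gain replaces) *)
Definition pick_best (v : {set U} -> R) (S L : {set U}) : option U :=
  foldl (fun acc x =>
           if x \in L :\: S then
             match acc with
             | None => Some x
             | Some y => if Rlt_dec (gain v S y) (gain v S x) then Some x else acc
             end
           else acc) None (enum 'I_n).

Definition greedy_step (v : {set U} -> R) (L S : {set U}) : {set U} :=
  match pick_best v S L with Some x => x |: S | None => S end.

Definition greedy (v : {set U} -> R) (k : nat) (L : {set U}) : {set U} :=
  iter (minn k #|L|) (greedy_step v L) set0.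

(* arrival order: the item arriving in round l (1-based) is sigma (l-1).
   U^{<= l} = items of rounds 1..l *)
Definition prefix (sigma : {perm U}) (l : nat) : {set U} :=
  [set sigma i | i : U & (nat_of_ord i < l)%nat].

(* Algorithm 1 with threshold round t = ceil(pn): rounds 1..t-1 rejected;
   in round l >= t the arriving item j is accepted iff j \in A(U^{<= l})
   and fewer than k items have been accepted. *)
Definition alg1_step (v : {set U} -> R) (k t : nat) (sigma : {perm U})
  (acc : {set U}) (i : U) : {set U} :=
  let j := sigma i in
  if [&& (t <= i.+1)%nat, j \in greedy v k (prefix sigma i.+1) & (#|acc| < k)%nat]
  then j |: acc else acc.

Definition alg1 (v : {set U} -> R) (k t : nat) (sigma : {perm U}) : {set U} :=
  foldl (alg1_step v k t sigma) set0 (enum 'I_n).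

Definition expected_alg1 (v : {set U} -> R) (k t : nat) : R :=
  foldr Rplus 0 [seq v (alg1 v k t s) | s <- enum [set: {perm U}]]
  / INR #|[set: {perm U}]|.

End Secretary.

Definition ratio_thm6 (k : nat) : R :=
  let e := exp 1 in
  (1 + 1 / (2 * e ^ 3) - 3 / (2 * e) - (e - 1) / (e ^ 2 * INR k)) / (e - 1)
  * (1 - sqrt (INR k - 1) / ((INR k + 1) * sqrt (2 * PI))).

(* Main.v *)
Require Import Defs.
From mathcomp Require Import all_boot all_fingroup.
From mathcomp Require Import Rstruct.
From Stdlib Require Import Factorial Reals Lra.
From Coquelicot Require Import Coquelicot.

(* Given the set of the first l arrivals and the order of the later ones, the item
   of round l is uniform in that set, so it lies in S^(l) with probability k/l, and by
   submodularity its expected contribution on top of any set B determined by the later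
   rounds is at least (v(S^(l)) - v(B))/l.  Hence the value V_r(l) collected from
   round l on with r free slots satisfies
     l V_r(l) >= (l - k) V_r(l+1) + (k - 1) V_{r-1}(l+1) + E v(S^(l)).
   Greedy run on a fraction p of the items has
   E v(S^(l)) >= p (1 - 1/(ek) - p/e) v(OPT), because k greedy steps approximate the
   m sampled optimal items up to the factor 1 - (1 - 1/m)^k >= 1 - m/(ek).
   The recursion is solved from below by means of E min(N, r), N a Poisson variable;
   for r = k and N of parameter k - 1, Stirling's lower bound for (k-1)! gives the
   factor 1 - sqrt(k-1)/((k+1) sqrt(2 pi)). *)

Set Implicit Arguments. Unset Strict Implicit. Unset Printing Implicit Defensive.
Local Open Scope R_scope.

(* Elaboration of ['I_n] leaves [reverse_coercion] marks in terms that are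
   otherwise identical, and the arithmetic tactics compare atoms syntactically. *)
Local Ltac slra := unfold reverse_coercion in *; lra.
Local Ltac snra := unfold reverse_coercion in *; nra.

Local Notation prefix := Defs.prefix.
Local Notation "\sum_ ( i <- r | P ) F" :=
  (\big[Rplus/0]_(i <- r | P%B) F) : R_scope.
Local Notation "\sum_ ( i : T | P ) F" :=
  (\big[Rplus/0]_(i : T | P%B) F) : R_scope.
Local Notation "\sum_ ( i 'in' A ) F" := (\big[Rplus/0]_(i in A) F) : R_scope.
Local Notation "\sum_ ( i : T ) F" := (\big[Rplus/0]_(i : T) F) : R_scope.

(** * Finite sums of real numbers *)

Lemma Rsum_le (I : Type) (r : seq I) (P : pred I) (F G : I -> R) :
  (forall i, P i -> F i <= G i) ->
  \sum_(i <- r | P i) F i <= \sum_(i <- r | P i) G i.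
Proof.
move=> FG; apply: (big_ind2 Rle) => //; first exact: Rle_refl.
by move=> *; apply: Rplus_le_compat.
Qed.

Lemma Rsum_const (I : finType) (A : {pred I}) c :
  \sum_(i in A) c = INR #|A| * c.
Proof.
rewrite big_const; elim: #|A| => [|m IHm]; first by rewrite /= Rmult_0_l.
by rewrite iterS IHm S_INR; lra.
Qed.

Lemma Rsum_scal (I : Type) (r : seq I) (P : pred I) (F : I -> R) c :
  \sum_(i <- r | P i) c * F i = c * \sum_(i <- r | P i) F i.
Proof. by rewrite big_distrr. Qed.

Lemma INR_leq m n : (m <= n)%nat -> INR m <= INR n.
Proof. by move/leP/le_INR. Qed.

(** * The greedy algorithm *)

Section Greedy.
Variables (n : nat) (v : {set 'I_n} -> R).
Hypotheses (v_ge0 : nonneg_fn v) (v_mono : monotone_fn v) (v_sub : submodular_fn v).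
Implicit Types (S L M A B : {set 'I_n}).

Lemma gain_ge0 S x : 0 <= gain v S x.
Proof.
by rewrite /gain; have := v_mono (subsetUr [set x] S); slra.
Qed.

(** Items of [A] are removed one at a time: submodularity for [A' :|: S] and [x |: S], whose
    intersection contains [S], bounds the increment due to [x] by its gain over [S]. *)
Lemma gain_set_le_sum A S : v (A :|: S) - v S <= \sum_(x in A) gain v S x.
Proof.
move: {2}#|A| (erefl #|A|) => m; elim: m A => [|m IHm] A.
  by move/eqP; rewrite cards_eq0 => /eqP->; rewrite set0U big_set0; slra.
move=> cardA; have /card_gt0P[x xA] : (0 < #|A|)%nat by rewrite cardA.
rewrite (big_setD1 x) //=; set A' := A :\ x.
have /IHm : #|A'| = m.
  by apply/eqP; rewrite -eqSS -cardA (cardsD1 x A) xA.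
have := v_sub (A' :|: S) (x |: S).
have -> : A' :|: S :|: (x |: S) = A :|: S.
  by rewrite setUACA setUid [A' :|: _]setUC (setD1K xA).
have := v_mono (_ : S \subset (A' :|: S) :&: (x |: S)).
rewrite subsetI !subsetUr => /(_ isT).
move=> H1 H2 IH; apply: Rle_trans _ (Rplus_le_compat_l _ _ _ IH).
by rewrite /gain; slra.
Qed.

Lemma pick_best_spec S L :
  match pick_best v S L with
  | Some x => x \in L :\: S /\ forall y, y \in L :\: S -> gain v S y <= gain v S x
  | None => L :\: S = set0
  end.
Proof.
rewrite /pick_best; set f := (fun _ _ => _).
(* Fold invariant, proved by appending items: the accumulator is a best candidate among those
   scanned so far. *)
have : match foldl f None (enum 'I_n) with
  | Some x => x \in L :\: S /\
      forall y, y \in enum 'I_n -> y \in L :\: S -> gain v S y <= gain v S x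
  | None => forall y, y \in enum 'I_n -> y \notin L :\: S end.
  elim/last_ind: (enum _) => [|s a]; first by [].
  rewrite foldl_rcons /f; case: (foldl _ _ s) => [x [xLS IH]|IH]; case: ifP => aLS.
  - case: Rlt_dec => ax; split=> // y; rewrite mem_rcons inE => /orP[/eqP->|ys] yLS;
      [slra | have := IH y ys yLS; slra | slra | exact: IH].
  - by split=> // y; rewrite mem_rcons inE => /orP[/eqP->|/IH//]; rewrite aLS.
  - split=> // y; rewrite mem_rcons inE => /orP[/eqP->|ys]; first by move=> _; slra.
    by rewrite (negPf (IH _ ys)).
  - by move=> y; rewrite mem_rcons inE => /orP[/eqP->|/IH//]; rewrite aLS.
case: (foldl _ _ _) => [x [xLS H]|H]; last first.
  by apply/setP => y; rewrite [RHS]inE; apply/negbTE/H; rewrite mem_enum.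
by split=> // y; apply: H; rewrite mem_enum.
Qed.

Lemma greedy_stepP L S : S \proper L ->
  exists x, [/\ greedy_step v L S = x |: S, x \in L :\: S &
    forall y, y \in L :\: S -> gain v S y <= gain v S x].
Proof.
move=> /properP[_ [y yL yS]]; rewrite /greedy_step.
case: pick_best (pick_best_spec S L) => [x [? ?]|LS]; first by exists x.
by have : y \in L :\: S; [rewrite inE yS | rewrite LS inE].
Qed.

Lemma iter_greedy_step_sub L i : (i <= #|L|)%nat ->
  iter i (greedy_step v L) set0 \subset L /\ #|iter i (greedy_step v L) set0| = i.
Proof.
elim: i => [|i IHi] iL; first by rewrite /= sub0set cards0.
have [sub card] := IHi (ltnW iL).
have /greedy_stepP[x [E]] : iter i (greedy_step v L) set0 \proper L.
  by rewrite properEcard sub card.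
rewrite iterS E inE => /andP[xS xL] _; split; first by rewrite subUset sub1set xL.
by rewrite cardsU1 xS card.
Qed.

Lemma greedy_sub k L : greedy v k L \subset L.
Proof. by have [] := iter_greedy_step_sub (geq_minr k #|L|). Qed.

Lemma card_greedy k L : #|greedy v k L| = minn k #|L|.
Proof. by have [] := iter_greedy_step_sub (geq_minr k #|L|). Qed.

(** The chosen item gains at least the average gain over [M], and the gains over [M] add up to at
    least [v M - v S]. *)
Lemma greedy_step_gap L S M : S \proper L -> M \subset L -> (0 < #|M|)%nat ->
  v M - v (greedy_step v L S) <= (1 - / INR #|M|) * (v M - v S).
Proof.
move=> /greedy_stepP[x [-> xLS xmax]] ML M0.
have Mpos : 0 < INR #|M| by apply/lt_0_INR/ltP.
suff H : v M - v S <= INR #|M| * gain v S x.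
  have : (v M - v S) / INR #|M| <= gain v S x.
    by apply/Rle_div_l => //; slra.
  by rewrite /gain /Rdiv; slra.
have := gain_set_le_sum M S; have := v_mono (subsetUl M S).
suff : \sum_(y in M) gain v S y <= INR #|M| * gain v S x by slra.
rewrite -Rsum_const; apply: Rsum_le => y yM.
have [yS|yS] := boolP (y \in S); last first.
  by apply: xmax; rewrite inE yS (subsetP ML).
(* An item of [M] already in [S] is not a candidate for the maximum, but it gains nothing. *)
have -> : gain v S y = 0; last exact: gain_ge0.
by rewrite /gain (setUidPr _) ?sub1set //; slra.
Qed.

Lemma greedy_gap k L M : M \subset L -> (0 < #|M|)%nat -> (k <= #|L|)%nat ->
  v M - v (greedy v k L) <= (1 - / INR #|M|) ^ k * v M.
Proof.
move=> ML M0 kL; rewrite /greedy (minn_idPl kL).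
have M1 : 1 <= INR #|M| by apply: (INR_leq M0).
have q0 : 0 <= 1 - / INR #|M|.
  by have := Rinv_le_contravar 1 _ Rlt_0_1 M1; rewrite Rinv_1; slra.
elim: k kL => [|k IHk] kL /=; first by have := v_ge0 set0; slra.
have [sub card] := iter_greedy_step_sub (ltnW kL).
have pr : iter k (greedy_step v L) set0 \proper L by rewrite properEcard sub card.
apply: Rle_trans (greedy_step_gap pr ML M0) _.
by rewrite Rmult_assoc; apply: Rmult_le_compat_l => //; apply/IHk/ltnW.
Qed.

(* [(1 - 1/m)^k <= exp (- k/m)] and [y exp (- y) <= exp (- 1)] at [y = k/m]. *)
Lemma pow_1_sub_inv_le m k : (0 < m)%nat -> (0 < k)%nat ->
  (1 - / INR m) ^ k <= INR m / (exp 1 * INR k).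
Proof.
move=> m0 k0.
have mpos : 0 < INR m by apply/lt_0_INR/ltP.
have kpos : 0 < INR k by apply/lt_0_INR/ltP.
have q0 : 0 <= 1 - / INR m.
  have := Rinv_le_contravar 1 _ Rlt_0_1 (INR_leq m0); rewrite Rinv_1; slra.
have e0 := exp_pos 1.
have H1 : (1 - / INR m) ^ k <= exp (- (INR k / INR m)).
  have -> : exp (- (INR k / INR m)) = exp (- / INR m) ^ k.
    elim: (k) => [|j IHj]; first by rewrite /= -exp_0; congr exp; rewrite /Rdiv; slra.
    rewrite /pow -/pow -IHj -exp_plus; congr exp.
    by rewrite S_INR; field; slra.
  by apply: pow_incr; split=> //; have := exp_ineq1_le (- / INR m); slra.
apply: Rle_trans H1 _; rewrite exp_Ropp.
have y0 : 0 < INR k / INR m by apply: Rdiv_lt_0_compat.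
have -> : INR m / (exp 1 * INR k) = / (exp 1 * (INR k / INR m)) by field; slra.
apply: Rinv_le_contravar; first exact: Rmult_lt_0_compat.
have -> : INR k / INR m = 1 + (INR k / INR m - 1) by slra.
rewrite exp_plus; apply: Rmult_le_compat_l; first slra.
have := exp_ineq1_le (INR k / INR m - 1).
have -> : 1 + (INR k / INR m - 1) = INR k / INR m by slra.
by [].
Qed.

(** The factor is made linear in [#|M|], so that for a random [M] only single and pairwise inclusion
    probabilities matter. *)
Lemma greedy_ge k L M : M \subset L -> (0 < k <= #|L|)%nat ->
  (1 - INR #|M| / (exp 1 * INR k)) * v M <= v (greedy v k L).
Proof.
move=> ML /andP[k0 kL]; have [|M0] := posnP #|M|.
  move/eqP; rewrite cards_eq0 => /eqP->; rewrite cards0 /= /Rdiv Rmult_0_l.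
  by have := v_mono (sub0set (greedy v k L)); slra.
have := greedy_gap ML M0 kL; have := pow_1_sub_inv_le M0 k0.
by have := v_ge0 M; snra.
Qed.

End Greedy.

(** * Uniformly random arrival orders *)

Lemma in_prefix (n : nat) (s : {perm 'I_n}) l x : (x \in prefix s l) = (s^-1%g x < l)%nat.
Proof.
apply/imsetP/idP => [[i]|xl]; first by rewrite inE => il ->; rewrite permK.
by exists (s^-1%g x); rewrite ?inE ?permKV.
Qed.

Lemma card_prefix (n : nat) (s : {perm 'I_n}) l : (l <= n)%nat -> #|prefix s l| = l.
Proof.
move=> ln; rewrite card_imset; last exact: perm_inj.
rewrite -sum1_card (eq_bigl (fun i : 'I_n => i < l)%nat); last by move=> i; rewrite !inE.
by rewrite -(big_ord_widen n (fun=> 1%nat) ln) sum1_card card_ord.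
Qed.

Section Mean.
Variable n : nat.
Implicit Types (s p : {perm 'I_n}) (f g : {perm 'I_n} -> R).

Definition mean f := (\sum_(s : {perm 'I_n}) f s) / INR #|[set: {perm 'I_n}]|.

Lemma card_perms_gt0 : 0 < INR #|[set: {perm 'I_n}]|.
Proof. by apply/lt_0_INR/ltP/card_gt0P; exists 1%g; rewrite inE. Qed.

Lemma eq_mean f g : f =1 g -> mean f = mean g.
Proof. by move=> fg; rewrite /mean; congr (_ / _); apply: eq_bigr => s _. Qed.

Lemma mean_le f g : (forall s, f s <= g s) -> mean f <= mean g.
Proof.
move=> fg; apply: Rmult_le_compat_r; last by apply: Rsum_le => s _.
exact/Rlt_le/Rinv_0_lt_compat/card_perms_gt0.
Qed.

Lemma mean_cst c : mean (fun=> c) = c.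
Proof.
have := card_perms_gt0; rewrite /mean.
have -> : \sum_(s : {perm 'I_n}) c = INR #|[set: {perm 'I_n}]| * c.
  by rewrite -Rsum_const; apply: eq_bigl => s; rewrite inE.
by move: (INR _) => N N0; field; lra.
Qed.

Lemma meanD f g : mean (fun s => f s + g s) = mean f + mean g.
Proof. by rewrite /mean big_split /= /Rdiv Rmult_plus_distr_r. Qed.

Lemma meanZ c f : mean (fun s => c * f s) = c * mean f.
Proof. by rewrite /mean Rsum_scal /Rdiv Rmult_assoc. Qed.

Lemma mean_sum (I : Type) (r : seq I) (P : pred I) (F : I -> {perm 'I_n} -> R) :
  mean (fun s => \sum_(i <- r | P i) F i s) = \sum_(i <- r | P i) mean (F i).
Proof. by rewrite /mean /Rdiv exchange_big big_distrl. Qed.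

(** Left multiplication permutes the rounds, right multiplication relabels the items; the uniform
    law is invariant under both. *)
Lemma mean_mulg_l p f : mean (fun s => f (p * s)%g) = mean f.
Proof.
by rewrite /mean [in RHS](reindex_inj (mulgI p)).
Qed.

Lemma mean_mulg_r p f : mean (fun s => f (s * p)%g) = mean f.
Proof.
by rewrite /mean [in RHS](reindex_inj (mulIg p)).
Qed.

Definition arrived l x s := INR (x \in prefix s l).

Lemma arrived_sqr l x s : arrived l x s * arrived l x s = arrived l x s.
Proof. by rewrite /arrived; case: (_ \in _) => /=; lra. Qed.

Lemma sum_arrived l (A : {set 'I_n}) s :
  \sum_(x in A) arrived l x s = INR #|A :&: prefix s l|.
Proof.
rewrite -sum1_card (big_morph INR plus_INR (erefl _)) /=.
rewrite [RHS]big_mkcond [LHS]big_mkcond; apply: eq_bigr => x _ /=.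
by rewrite inE /arrived; case: (x \in A); case: (x \in _).
Qed.

Lemma arrived_tperm l x y z s :
  arrived l z (s * tperm x y)%g = arrived l (tperm x y z) s.
Proof. by rewrite /arrived !in_prefix invMg tpermV permM. Qed.

(** Relabelling by a transposition gives all items the same mean, and the indicators add up to
    [l]. *)
Lemma mean_arrived l x : (l <= n)%nat -> INR n * mean (arrived l x) = INR l.
Proof.
move=> ln.
have E y : mean (arrived l y) = mean (arrived l x).
  rewrite -(mean_mulg_r (tperm x y) (arrived l y)).
  by apply: eq_mean => s; rewrite arrived_tperm tpermR.
have : \sum_(y in [set: 'I_n]) mean (arrived l y) = INR l.
  rewrite -mean_sum -[RHS]mean_cst; apply: eq_mean => s.
  by rewrite sum_arrived setTI card_prefix.
by rewrite (eq_bigr (fun=> mean (arrived l x))) // Rsum_const cardsT card_ord.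
Qed.

(** By relabelling, every partner of [x] has the same pair mean; once [x] has arrived, exactly
    [l - 1] partners have. *)
Lemma mean_arrived_pair l x y : (l <= n)%nat -> x != y ->
  (INR n - 1) * mean (fun s => arrived l x s * arrived l y s) =
  (INR l - 1) * mean (arrived l x).
Proof.
move=> ln xy.
have n0 : (0 < n)%nat by apply: leq_ltn_trans (leq0n x) (ltn_ord x).
have E z : z != x -> mean (fun s => arrived l x s * arrived l z s) =
    mean (fun s => arrived l x s * arrived l y s).
  move=> zx; rewrite -[RHS](mean_mulg_r (tperm y z)).
  apply: eq_mean => s; rewrite !arrived_tperm tpermL.
  by rewrite tpermD // eq_sym.
have : \sum_(z in [set~ x]) mean (fun s => arrived l x s * arrived l z s) =
    (INR l - 1) * mean (arrived l x).
  rewrite -mean_sum -meanZ; apply: eq_mean => s.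
  rewrite Rsum_scal; have := sum_arrived l [set: 'I_n] s.
  rewrite setTI card_prefix // (big_setD1 x) ?inE //= setTD => H.
  by have := arrived_sqr l x s; rewrite -H; slra.
rewrite (eq_bigr (fun=> mean (fun s => arrived l x s * arrived l y s))); last first.
  by move=> z; rewrite !inE; exact: E.
rewrite Rsum_const cardsC1 card_ord => <-.
by have -> : INR n.-1 = INR n - 1 by rewrite -[in RHS](prednK n0) S_INR; lra.
Qed.

(** The diagonal term gives [l / n]; each other pair gives at most its square, since sampling
    without replacement is negatively correlated: [(l - 1) / (n - 1) <= l / n]. *)
Lemma mean_arrived_card l (A : {set 'I_n}) x : (l <= n)%nat -> (1 < n)%nat -> x \in A ->
  mean (fun s => arrived l x s * INR #|A :&: prefix s l|) <=
  INR l / INR n + INR #|A| * (INR l / INR n) ^ 2.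
Proof.
move=> ln n1 xA.
have n1' : 2 <= INR n by apply: (INR_leq n1).
have ln' := INR_leq ln; have l0 := pos_INR l.
have mx : mean (arrived l x) = INR l / INR n.
  by rewrite -(mean_arrived x ln); field; lra.
set p := INR l / INR n in mx *.
have p01 : 0 <= p <= 1.
  split; first by apply: Rdiv_le_0_compat; lra.
  by apply/Rle_div_l; lra.
have pE : p * INR n = INR l by rewrite /p; field; lra.
have pair y : y \in A :\ x ->
    mean (fun s => arrived l x s * arrived l y s) <= p ^ 2.
  rewrite !inE eq_sym => /andP[xy _].
  by have := mean_arrived_pair ln xy; rewrite mx -pE; nra.
rewrite (eq_mean (g := fun s => arrived l x s +
  \sum_(y in A :\ x) arrived l x s * arrived l y s)); last first.
  move=> s; rewrite Rsum_scal -sum_arrived (big_setD1 x) //=.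
  by rewrite Rmult_plus_distr_l arrived_sqr.
rewrite meanD mean_sum mx; apply: Rplus_le_compat_l.
apply: Rle_trans (_ : INR #|A :\ x| * p ^ 2 <= _).
  by rewrite -Rsum_const; apply: Rsum_le.
apply: Rmult_le_compat_r; first exact: pow2_ge_0.
exact/INR_leq/subset_leq_card/subsetDl.
Qed.

End Mean.

(** The weights are the marginals along an ordering of [O], a vertex of the base polytope. They
    replace [v] on a random part of [O] by a linear function, whose product with the size of that
    part has a computable mean. *)
Lemma submodular_additive_minorant (n : nat) (v : {set 'I_n} -> R) (O : {set 'I_n}) :
  monotone_fn v -> submodular_fn v ->
  exists a : 'I_n -> R, [/\ forall x, 0 <= a x,
    forall M : {set 'I_n}, M \subset O -> v set0 + \sum_(x in M) a x <= v M &
    v set0 + \sum_(x in O) a x = v O].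
Proof.
move=> v_mono v_sub.
move: {2}#|O| (erefl #|O|) => m; elim: m O => [|m IHm] O.
  move/eqP; rewrite cards_eq0 => /eqP->; exists (fun=> 0); split.
  - by move=> _; lra.
  - by move=> M; rewrite subset0 => /eqP->; rewrite big_set0; slra.
  - by rewrite big_set0; slra.
move=> cardO; have /card_gt0P[y yO] : (0 < #|O|)%nat by rewrite cardO.
have [|a [a0 aM aO]] := IHm (O :\ y).
  by apply/eqP; rewrite -eqSS -cardO (cardsD1 y O) yO.
pose b x := if x == y then v O - v (O :\ y) else a x.
have bE (M : {set 'I_n}) : \sum_(x in M :\ y) b x = \sum_(x in M :\ y) a x.
  by apply: eq_bigr => x; rewrite !inE /b => /andP[/negPf->].
exists b; split.
- move=> x; rewrite /b; case: ifP => // _.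
  by have := v_mono _ _ (subD1set O y); slra.
- move=> M MO; have [yM|yM] := boolP (y \in M); last first.
    have MD : M :\ y = M by apply/setP => x; rewrite !inE; case: eqP => // ->; rewrite (negPf yM).
    by rewrite -MD bE; apply: aM; rewrite setSD.
  rewrite (big_setD1 y) //= bE {1}/b eqxx.
  have := aM (M :\ y) (setSD _ MO); have := v_sub M (O :\ y).
  have -> : M :|: O :\ y = O.
    apply/setP => x; rewrite !inE; case: eqP => [->|_] /=; first by rewrite yM yO.
    by case: (boolP (x \in M)) => // /(subsetP MO)->.
  have -> : M :&: (O :\ y) = M :\ y.
    apply/setP => x; rewrite !inE; case: eqP => [->|_] /=; first by rewrite andbF.
    by case: (boolP (x \in M)) => // /(subsetP MO)->.
  by set S := \big[_/_]_(_ in _) _; slra.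
- by rewrite (big_setD1 y) //= bE {1}/b eqxx; rewrite -aO; slra.
Qed.

Lemma mean_greedy_ge (n : nat) (v : {set 'I_n} -> R) (O : {set 'I_n}) l :
  nonneg_fn v -> monotone_fn v -> submodular_fn v ->
  (0 < #|O| <= l)%nat -> (1 < n)%nat -> (l <= n)%nat ->
  let p := INR l / INR n in
  p * (1 - / (exp 1 * INR #|O|) - p / exp 1) * v O <=
  mean (fun s => v (greedy v #|O| (prefix s l))).
Proof.
move=> v_ge0 v_mono v_sub /andP[k0 kl] n1 ln p.
have [a [a0 aM aO]] := submodular_additive_minorant O v_mono v_sub.
set k := #|O| in k0 kl *; set d := / (exp 1 * INR k).
have k1 : 1 <= INR k by apply: (INR_leq k0).
have e2 : 2 <= exp 1 by have := exp_ineq1_le 1; lra.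
have ek1 : 1 <= exp 1 * INR k by nra.
have d0 : 0 < d by apply: Rinv_0_lt_compat; lra.
have dk : d * INR k = / exp 1 by rewrite /d; field; split; lra.
have e1 : / exp 1 <= / 2 by apply: Rinv_le_contravar; lra.
have n2 : 2 <= INR n by apply: (INR_leq n1).
have ln' := INR_leq ln; have l0 := pos_INR l.
have p01 : 0 <= p <= 1.
  split; first by apply: Rdiv_le_0_compat; lra.
  by apply/Rle_div_l; lra.
have mx (x : 'I_n) : mean (arrived l x) = p.
  by rewrite /p -(mean_arrived x ln); field; lra.
pose c (s : {perm 'I_n}) := INR #|O :&: prefix s l|.
have cE s : c s = \sum_(x in O) arrived l x s by rewrite sum_arrived.
have ck s : 0 <= c s <= INR k.
  by split; [exact: pos_INR | exact/INR_leq/subset_leq_card/subsetIl].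
(* [F] expands the product of the greedy factor [1 - d * c s] with the additive minorant of
   [v (O :&: prefix s l)]. *)
pose F (s : {perm 'I_n}) := v set0 + (- d * v set0) * c s +
  \sum_(x in O) a x * (arrived l x s + - d * (arrived l x s * c s)).
apply: Rle_trans (_ : _ <= mean F) _; last first.
  apply: mean_le => s.
  have kP : (0 < k <= #|prefix s l|)%nat by rewrite card_prefix // k0.
  apply: Rle_trans (greedy_ge v_ge0 v_mono v_sub (subsetIr O (prefix s l)) kP).
  have -> : F s = (1 - d * c s) * (v set0 + \sum_(x in O) a x * arrived l x s).
    rewrite Rmult_plus_distr_l -Rsum_scal /F; congr (_ + _); first by ring.
    by apply: eq_bigr => x _; ring.
  rewrite -/(c s) /Rdiv -/d [c s * d]Rmult_comm; apply: Rmult_le_compat_l.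
    by have := ck s; nra.
  apply: Rle_trans (aM _ (subsetIl _ _)); apply: Rplus_le_compat_l.
  rewrite [X in _ <= X]big_mkcond [X in X <= _]big_mkcond; apply: Rsum_le => x _.
  rewrite inE /arrived; case: (x \in O) => /=; last by lra.
  by case: ifP => /=; lra.
rewrite /F meanD mean_sum meanD mean_cst meanZ.
have -> : mean c = p * INR k.
  rewrite (eq_mean cE) mean_sum (eq_bigr (fun=> p)) //.
  by rewrite Rsum_const; exact: Rmult_comm.
set h := p * _.
have hE : h = p - d * p - p ^ 2 / exp 1 by rewrite /h /d /Rdiv; ring.
(* The comparison is termwise: [v set0] has coefficient [1 - p / exp 1 >= h] in [mean F], and each
   [a x] at least [p - d * (p + k * p ^ 2) = h]. *)
apply: Rle_trans (_ : h * v set0 + \sum_(x in O) h * a x <= _).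
  by rewrite Rsum_scal -aO; right; slra.
apply: Rplus_le_compat.
  have := v_ge0 set0; rewrite hE /Rdiv => v00.
  have : - d * v set0 * (p * INR k) = - (p * / exp 1 * v set0) by rewrite -dk; ring.
  move=> ->.
  have : 0 <= v set0 * (1 - p * / exp 1 - (p - d * p - p ^ 2 * / exp 1)); last by slra.
  apply: Rmult_le_pos => //; set i := / exp 1 in dk e1 *.
  have i0 : 0 < i by apply: Rinv_0_lt_compat; lra.
  have -> : 1 - p * i - (p - d * p - p ^ 2 * i) = (1 - p) * (1 - p * i) + d * p by ring.
  have pi1 : 0 <= 1 - p * i by nra.
  by apply: Rplus_le_le_0_compat; apply: Rmult_le_pos; lra.
apply: Rsum_le => x xO; rewrite meanZ meanD meanZ mx Rmult_comm.
apply: Rmult_le_compat_l => //.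
have := mean_arrived_card ln n1 xO; rewrite -/p -/k -/(c _) => H.
rewrite hE /Rdiv -dk.
have := Rmult_le_compat_l d _ _ (Rlt_le _ _ d0) H.
rewrite /c; slra.
Qed.

(** * The recursion on free slots *)

(** Positions count from 0, so these are the 1-based rounds [l + 1] to [n]. *)
Definition rounds (n l : nat) : seq 'I_n := [seq i : 'I_n <- enum 'I_n | (l <= i)%nat].

Lemma rounds_cons (n : nat) (i : 'I_n) : rounds n i = i :: rounds n i.+1.
Proof.
have E m : map val (rounds n m) = [seq j <- seq.iota 0 n | (m <= j)%nat].
  by rewrite /rounds -val_enum_ord filter_map.
apply: (inj_map val_inj); rewrite map_cons !E.
have -> : seq.iota 0 n = seq.iota 0 i ++ val i :: seq.iota i.+1 (n - i.+1).
  by rewrite -[in LHS](subnKC (ltn_ord i)) -addn1 iotaD -addn1 iotaD -catA.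
have low m : (i <= m)%nat -> [seq j <- seq.iota 0 i | (m <= j)%nat] = [::].
  move=> im; apply/eqP; rewrite -size_eq0 size_filter -leqn0 leqNgt -has_count.
  apply/hasPn => j; rewrite mem_iota add0n => /andP[_ ji].
  by rewrite -ltnNge (leq_trans ji).
rewrite !filter_cat !low //= leqnn ltnn; congr (_ :: _).
have high m : (m <= i.+1)%nat ->
    [seq j <- seq.iota i.+1 (n - i.+1) | (m <= j)%nat] = seq.iota i.+1 (n - i.+1).
  move=> mi; apply/all_filterP/allP => j; rewrite mem_iota => /andP[ij _].
  exact: leq_trans mi ij.
by rewrite !high.
Qed.

Section Picks.
Variables (n : nat) (v : {set 'I_n} -> R) (k : nat).
Implicit Types (s : {perm 'I_n}) (i j x : 'I_n) (A S : {set 'I_n}).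

(* Items accepted by a run over the rounds [l] starting with [r] free slots. *)
Fixpoint picks s (r : nat) (l : seq 'I_n) : {set 'I_n} :=
  match l, r with
  | i :: l', r'.+1 =>
      if s i \in greedy v k (prefix s i.+1) then s i |: picks s r' l' else picks s r l'
  | _, _ => set0
  end.

Lemma picks0 s l : picks s 0 l = set0.
Proof. by case: l. Qed.

(** The forward fold depends on its accumulator only through the number of free slots: pending items
    lie outside [A], so each acceptance uses exactly one slot. *)
Lemma foldl_alg1_step t s A l : uniq l -> (forall i, i \in l -> s i \notin A) ->
  foldl (alg1_step v k t s) A l =
  A :|: picks s (k - #|A|) [seq i : 'I_n <- l | (t <= i.+1)%nat].
Proof.
elim: l A => [|i l IHl] A /=; first by rewrite setU0.
move=> /andP[il ul] sA.
have sA' j : j \in l -> s j \notin A by move=> jl; apply: sA; rewrite inE jl orbT.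
rewrite {2}/alg1_step; case: (t <= i.+1)%nat => /=; last exact: IHl.
have [iG|iG] /= := boolP (s i \in _); last first.
  by rewrite IHl //; case: (k - #|A|)%nat => [|r] /=; rewrite ?picks0 // (negPf iG).
case: (ltnP #|A| k) => Ak; last first.
  by rewrite IHl // (eqP Ak) /= !picks0.
rewrite IHl //; last first.
  move=> j jl; rewrite !inE negb_or sA' // andbT.
  by apply/eqP => /perm_inj ji; rewrite -ji jl in il.
rewrite cardsU1 sA ?inE ?eqxx // add1n -[in RHS](subnSK Ak) /=.
by rewrite setUCA setUA.
Qed.

Lemma alg1_picks t s : alg1 v k t.+1 s = picks s k (rounds n t).
Proof.
rewrite /alg1 foldl_alg1_step ?enum_uniq //; last by move=> i _; rewrite inE.
by rewrite cards0 subn0 set0U.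
Qed.

Lemma eq_picks s s' r l :
  (forall i, i \in l -> s' i = s i /\ prefix s' i.+1 = prefix s i.+1) ->
  picks s' r l = picks s r l.
Proof.
elim: l r => [|i l IHl] [|r] //= ss'.
have [-> ->] := ss' i (mem_head i l).
by rewrite !IHl // => j jl; apply: ss'; rewrite inE jl orbT.
Qed.

Lemma prefix_tpermM s i j l : (i < l)%nat -> (j < l)%nat ->
  prefix (tperm j i * s)%g l = prefix s l.
Proof.
move=> il jl; apply/setP => x; rewrite !in_prefix invMg tpermV permM.
by case: tpermP => [->|->|//]; rewrite il jl.
Qed.

(** Swapping two positions up to [i] changes neither the later arrivals nor the sets seen at later
    rounds. *)
Lemma picks_tpermM s i j r : (j <= i)%nat ->
  picks (tperm j i * s)%g r (rounds n i.+1) = picks s r (rounds n i.+1).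
Proof.
move=> ji; apply: eq_picks => m; rewrite mem_filter => /andP[im _].
split; last by apply: prefix_tpermM; rewrite ltnS ?(leq_trans ji) // ltnW.
by rewrite permM tpermD // neq_ltn ?im ?(leq_ltn_trans ji im).
Qed.

Definition mean_picks r l := mean (fun s => v (picks s r (rounds n l))).

(* Given the set of the first [i+1] arrivals and the order of the later ones,
   every item of that set is equally likely to arrive in round [i+1]. *)
Lemma mean_last_arrival i (f : {perm 'I_n} -> R) :
  INR i.+1 * mean f =
  mean (fun s => \sum_(j : 'I_n | (j <= i)%nat) f (tperm j i * s)%g).
Proof.
rewrite mean_sum (eq_bigr (fun=> mean f)) => [|j _]; last exact: mean_mulg_l.
have -> : INR i.+1 = INR #|[pred j : 'I_n | (j <= i)%nat]|.
  congr INR; rewrite -sum1_card -[LHS]card_ord -sum1_card.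
  by rewrite (big_ord_widen n (fun=> 1%nat) (ltn_ord i)).
by rewrite -Rsum_const.
Qed.

Hypotheses (v_mono : monotone_fn v) (v_sub : submodular_fn v).

Lemma mean_picks_rec i r : (0 < k <= i.+1)%nat ->
  (INR i.+1 - INR k) * mean_picks r.+1 i.+1 + (INR k - 1) * mean_picks r i.+1 +
    mean (fun s => v (greedy v k (prefix s i.+1))) <=
  INR i.+1 * mean_picks r.+1 i.
Proof.
move=> /andP[k0 ki]; rewrite mean_last_arrival -!meanZ -!meanD.
apply: mean_le => s; set w := INR i.+1.
set G := greedy v k (prefix s i.+1); set B' := picks s r.+1 _; set B := picks s r _.
have cardG : #|G| = k by rewrite card_greedy card_prefix // (minn_idPl ki).
have GP : G \subset prefix s i.+1 by apply: greedy_sub.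
(* The swaps let each item of the prefix arrive last once: those in [G] take a slot and leave [r],
   the others leave [r.+1]. *)
have -> : \sum_(j : 'I_n | (j <= i)%nat) v (picks (tperm j i * s)%g r.+1 (rounds n i)) =
    \sum_(x in prefix s i.+1) if x \in G then v (x |: B) else v B'.
  rewrite [RHS]big_imset /=; last by move=> ? ? _ _; apply: perm_inj.
  rewrite [RHS](eq_bigl (fun j : 'I_n => j <= i)%nat); last by move=> j; rewrite !inE ltnS.
  apply: eq_bigr => j ji; rewrite rounds_cons /= permM tpermR prefix_tpermM ?ltnS //.
  by rewrite -/G !picks_tpermM //; case: ifP.
rewrite (big_setID G) /= (setIidPr GP).
rewrite (eq_bigr (fun x => gain v B x + v B)); last first.
  by move=> x ->; rewrite /gain; slra.
rewrite big_split /= Rsum_const cardG.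
rewrite [X in _ <= _ + X](eq_bigr (fun=> v B')); last first.
  by move=> x; rewrite inE => /andP[/negPf->].
rewrite Rsum_const cardsD (setIidPr GP) cardG card_prefix // minus_INR; last exact/leP.
rewrite -/w.
(* The gains over [B] add up to at least [v G - v B]; the subtracted [v B] turns the weight [k] into
   [k - 1]. *)
have H1 := gain_set_le_sum v_mono v_sub G B; have H2 := v_mono (subsetUl G B).
apply: Rle_trans (_ : _ <= v (G :|: B) - v B + INR k * v B + (w - INR k) * v B') _.
  by slra.
by apply/Rplus_le_compat_r/Rplus_le_compat_r.
Qed.

End Picks.

(** * Wallis' inequality *)

Definition sin_pow_int m := RInt (fun x => sin x ^ m) 0 (PI / 2).

Lemma ex_RInt_sin_pow m a b : ex_RInt (fun x => sin x ^ m) a b.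
Proof.
apply: ex_RInt_continuous => z _; apply: ex_derive_continuous.
by auto_derive.
Qed.

Lemma sin_pow_int0 : sin_pow_int 0 = PI / 2.
Proof.
rewrite /sin_pow_int (RInt_ext _ (fun=> 1)) ?RInt_const //.
by rewrite /scal /= /mult /=; lra.
Qed.

Lemma sin_pow_int1 : sin_pow_int 1 = 1.
Proof.
apply: is_RInt_unique; have -> : 1 = minus (- cos (PI / 2)) (- cos 0).
  by rewrite cos_PI2 cos_0 /minus /plus /opp /=; lra.
apply: (is_RInt_derive (fun x => - cos x)) => x _; first by auto_derive => //; ring.
by apply: ex_derive_continuous; auto_derive.
Qed.

Lemma sin_pow_int_rec m :
  INR m.+2 * sin_pow_int m.+2 = INR m.+1 * sin_pow_int m.
Proof.
pose f x := INR m.+2 * sin x ^ m.+2 - INR m.+1 * sin x ^ m.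
(* Integration by parts: the primitive [- cos x * sin x ^ m.+1] vanishes at both ends. *)
have H1 : is_RInt f 0 (PI / 2) 0.
  have {2}-> : 0 = minus (- cos (PI / 2) * sin (PI / 2) ^ m.+1) (- cos 0 * sin 0 ^ m.+1).
    by rewrite cos_PI2 sin_0 /minus /plus /opp /=; lra.
  apply: (is_RInt_derive (fun x => - cos x * sin x ^ m.+1)) => x _.
    rewrite /f; auto_derive => //.
    have := sin2_cos2 x; rewrite /Rsqr => sc.
    have c2 : cos x * cos x = 1 - sin x * sin x by lra.
    change (match m with O => 1 | S _ => INR m + 1 end) with (INR m.+1).
    rewrite (S_INR m.+1); move: (INR m.+1) => M /=.
    transitivity (sin x * (sin x * sin x ^ m) - M * (cos x * cos x) * sin x ^ m); first by ring.
    by rewrite c2; ring.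
  by apply: ex_derive_continuous; rewrite /f; auto_derive.
have H2 : is_RInt f 0 (PI / 2) (INR m.+2 * sin_pow_int m.+2 - INR m.+1 * sin_pow_int m).
  apply: is_RInt_minus; apply: is_RInt_scal; apply: RInt_correct;
    exact: ex_RInt_sin_pow.
have := is_RInt_unique _ _ _ _ H1; rewrite (is_RInt_unique _ _ _ _ H2); lra.
Qed.

Lemma sin_pow_int_decr m : sin_pow_int m.+1 <= sin_pow_int m.
Proof.
have pi0 := PI_RGT_0.
apply: RInt_le; try exact: ex_RInt_sin_pow; first by lra.
move=> x x01; have s0 : 0 < sin x by apply: sin_gt_0; lra.
have [_ s1] := SIN_bound x; have sm := pow_lt _ m s0.
by rewrite /= -[X in _ <= X]Rmult_1_l; apply: Rmult_le_compat_r; lra.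
Qed.

(** By the two-step recursion the left side does not depend on [m]. *)
Lemma sin_pow_int_mul m : INR m.+1 * (sin_pow_int m.+1 * sin_pow_int m) = PI / 2.
Proof.
elim: m => [|m IHm]; first by rewrite sin_pow_int0 sin_pow_int1 /=; lra.
by rewrite -IHm -Rmult_assoc sin_pow_int_rec; ring.
Qed.

(** The central binomial coefficient of [2m] over [m], divided by [4 ^ m]. *)
Definition central_binom_ratio m := INR (fact (m + m)) / (4 ^ m * INR (fact m) ^ 2).

Lemma sin_pow_int_even m : sin_pow_int (m + m) = PI / 2 * central_binom_ratio m.
Proof.
elim: m => [|m IHm]; first by rewrite sin_pow_int0 /central_binom_ratio /=; field.
have := sin_pow_int_rec (m + m); rewrite IHm addSn addnS.
have f0 := INR_fact_neq_0 m; have m0 : INR m + 1 <> 0 by have := pos_INR m; lra.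
have fp : (4 ^ m)%R <> 0 by apply: pow_nonzero; lra.
rewrite /central_binom_ratio addSn addnS !fact_simpl !mult_INR !S_INR plus_INR => H.
apply: (Rmult_eq_reg_l (INR m + INR m + 1 + 1)); last by have := pos_INR m; lra.
rewrite {}H; move: (INR (fact (m + m))) => F /=; field; by [].
Qed.

(** Write [J] for the integral of exponent [2m] and [J'] for the preceding one. As [J <= J'],
    [2m * J ^ 2 <= 2m * J * J' = PI / 2], and [J] is [PI / 2] times the ratio. *)
Lemma central_binom_ratio_le m : PI * INR m * central_binom_ratio m ^ 2 <= 1.
Proof.
case: m => [|m]; first by rewrite /=; lra.
have pi0 := PI_RGT_0.
have Jpos : 0 <= sin_pow_int (m.+1 + m.+1).
  apply: RInt_ge_0; [lra | exact: ex_RInt_sin_pow |] => x x01.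
  by apply: pow_le; apply: Rlt_le; apply: sin_gt_0; lra.
have := sin_pow_int_decr (m + m.+1); have := sin_pow_int_mul (m + m.+1).
have -> : (m + m.+1).+1 = (m.+1 + m.+1)%nat by rewrite addSn.
set J := sin_pow_int (m.+1 + m.+1) in Jpos *; move: (sin_pow_int _) => J'.
have JE : J = PI / 2 * central_binom_ratio m.+1 by apply: sin_pow_int_even.
rewrite plus_INR; set N := INR m.+1 => E JJ'.
have N0 : 0 <= N by apply: pos_INR.
have : (N + N) * (J * J) <= PI / 2.
  by rewrite -E; apply: Rmult_le_compat_l; [lra | apply: Rmult_le_compat_l].
rewrite JE; set w := central_binom_ratio _ => H.
apply: (Rmult_le_reg_l (PI / 2)); first by lra.
by rewrite Rmult_1_r; apply: Rle_trans H; right; field.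
Qed.

(** * Truncated Poisson means *)

Section Poisson.
Variable a : R.
Hypothesis a0 : 0 < a.
Implicit Types (x y d : R) (r j : nat).

Definition pois j x := exp (- (a * x)) * (a * x) ^ j / INR (fact j).

Fixpoint poisQ r x := if r is r'.+1 then poisQ r' x + pois r' x else 0.

(* [a * capped_mean r x] is the mean of [min(N, r)], [N] Poisson of parameter [a x]. *)
Fixpoint capped_mean r x :=
  if r is r'.+1 then capped_mean r' x + (1 - poisQ r x) / a else 0.

Lemma capped_meanS r x :
  a * capped_mean r.+1 x = a * capped_mean r x + (1 - poisQ r.+1 x).
Proof. by rewrite /=; field; lra. Qed.

Lemma poisS j x : INR j.+1 * pois j.+1 x = a * x * pois j x.
Proof.
rewrite /pois fact_simpl mult_INR; have f0 := INR_fact_neq_0 j.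
have j0 : INR j.+1 <> 0 by apply: not_0_INR.
by rewrite [_ ^ j.+1]/=; field.
Qed.

Lemma pois_ge0 j x : 0 <= x -> 0 <= pois j x.
Proof.
move=> x0; apply: Rmult_le_pos; last exact/Rlt_le/Rinv_0_lt_compat/INR_fact_lt_0.
by apply: Rmult_le_pos; [exact/Rlt_le/exp_pos | apply: pow_le; nra].
Qed.

Lemma is_derive_poisQ r x : is_derive (poisQ r.+1) x (- a * pois r x).
Proof.
elim: r x => [|r IHr] x.
  apply: (is_derive_ext (fun y => exp (- (a * y)))).
    by move=> y /=; rewrite /pois /=; field.
  by rewrite /pois /=; auto_derive => //; field.
have -> : - a * pois r.+1 x = plus (- a * pois r x) (a * (pois r x - pois r.+1 x)).
  by rewrite /plus /=; ring.
apply: (is_derive_plus (poisQ r.+1) (pois r.+1)); first exact: IHr.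
rewrite /pois; auto_derive => //.
change (match r with O => 1 | S _ => INR r + 1 end) with (INR r.+1).
change (fact r + r * fact r)%coq_nat with (fact r.+1).
rewrite fact_simpl mult_INR; have f0 := INR_fact_neq_0 r.
have j0 : INR r.+1 <> 0 by apply: not_0_INR.
by rewrite [(a * x) ^ r.+1]/=; field.
Qed.

(** Differentiating a Poisson tail telescopes to a single weight, and these weights add up to the
    probability that the cap is not reached. *)
Lemma is_derive_capped_mean r x : is_derive (capped_mean r) x (poisQ r x).
Proof.
elim: r x => [|r IHr] x; first exact: is_derive_const.
have -> : poisQ r.+1 x = plus (poisQ r x) (- (- a * pois r x) / a).
  by rewrite /plus /=; field; lra.
apply: (is_derive_plus (capped_mean r) (fun y => (1 - poisQ r.+1 y) / a)) => //.
have D := is_derive_poisQ r x; move: (poisQ r.+1) D => f D.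
auto_derive; first by exists (- a * pois r x).
by rewrite (is_derive_unique _ _ _ D); field; lra.
Qed.

Lemma poisQ_decr r x y : 0 <= x -> x <= y -> poisQ r y <= poisQ r x.
Proof.
case: r => [|r] x0 xy; first by rewrite /=; lra.
have [z [zxy E]] := MVT_gen (poisQ r.+1) x y (fun z => - a * pois r z)
  (fun z _ => is_derive_poisQ r z)
  (fun z _ => proj2 (continuity_pt_filterlim _ _)
     (ex_derive_continuous _ _ (ex_intro _ _ (is_derive_poisQ r z)))).
rewrite Rmin_left // Rmax_right // in zxy.
have : 0 <= a * pois r z * (y - x).
  apply: Rmult_le_pos; last lra.
  by apply: Rmult_le_pos; [lra | apply: pois_ge0; lra].
by lra.
Qed.

Lemma poisQ_ge0 r x : 0 <= x -> 0 <= poisQ r x.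
Proof.
move=> x0; elim: r => [|r IHr] /=; first lra.
by have := pois_ge0 r x0; lra.
Qed.

Lemma poisQ_at0 r : poisQ r.+1 0 = 1.
Proof.
elim: r => [|r IHr]; first by rewrite /= /pois /= Rmult_0_r Ropp_0 exp_0; field.
by rewrite /= in IHr *; rewrite IHr /pois Rmult_0_r /= /Rdiv; ring.
Qed.

Lemma poisQ_le1 r x : 0 <= x -> poisQ r x <= 1.
Proof.
case: r => [|r] x0; first by rewrite /=; lra.
by rewrite -(poisQ_at0 r); apply: poisQ_decr; lra.
Qed.

Lemma capped_mean_at0 r : capped_mean r 0 = 0.
Proof.
elim: r => // r IHr; rewrite /capped_mean -/capped_mean IHr poisQ_at0.
by rewrite Rminus_diag /Rdiv; ring.
Qed.

Lemma capped_mean_MVT r x y : 0 <= x -> x <= y ->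
  exists2 z, x <= z <= y & capped_mean r y - capped_mean r x = poisQ r z * (y - x).
Proof.
move=> x0 xy.
have [z [zxy E]] := MVT_gen (capped_mean r) x y (poisQ r)
  (fun z _ => is_derive_capped_mean r z)
  (fun z _ => proj2 (continuity_pt_filterlim _ _)
     (ex_derive_continuous _ _ (ex_intro _ _ (is_derive_capped_mean r z)))).
by rewrite Rmin_left // Rmax_right // in zxy; exists z.
Qed.

Lemma capped_mean_incr r x y : 0 <= x -> x <= y -> capped_mean r x <= capped_mean r y.
Proof.
move=> x0 xy; have [z zxy E] := capped_mean_MVT r x0 xy.
have z0 : 0 <= z by lra.
by have := poisQ_ge0 r z0; nra.
Qed.

(** The derivative [poisQ] decreases, so an Euler step overestimates; expressing [poisQ] by
    consecutive capped means gives the shape of the free-slot recursion. *)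
Lemma capped_mean_step r x d : 0 <= x -> 0 <= d ->
  capped_mean r.+1 (x + d) <=
  (1 - a * d) * capped_mean r.+1 x + a * d * capped_mean r x + d.
Proof.
move=> x0 d0; have [||z zxd E] := @capped_mean_MVT r.+1 x (x + d); try lra.
have H : poisQ r.+1 z <= poisQ r.+1 x by apply: poisQ_decr; lra.
have Q : poisQ r.+1 x = 1 - a * (capped_mean r.+1 x - capped_mean r x).
  by rewrite Rmult_minus_distr_l capped_meanS; ring.
by rewrite Q in H; nra.
Qed.

Lemma capped_mean_le r x : 0 <= x -> capped_mean r x <= x.
Proof.
move=> x0; have [z zx E] := capped_mean_MVT r (Rle_refl 0) x0.
rewrite capped_mean_at0 in E; have z0 : 0 <= z by lra.
by have := poisQ_le1 r z0; nra.
Qed.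

(** The mean of [min(N, r+1)] is split at the cap; below it, [j P(N = j) = a x P(N = j-1)] shifts
    the sum by one. *)
Lemma capped_meanE r x :
  a * capped_mean r.+1 x = INR r.+1 * (1 - poisQ r.+1 x) + a * x * poisQ r x.
Proof.
elim: r => [|r IHr].
  by rewrite /=; field; lra.
rewrite capped_meanS IHr; have := poisS r x; rewrite [poisQ r.+2 x]/= -/(poisQ r.+1 x).
have -> : poisQ r.+1 x = poisQ r x + pois r x by [].
by rewrite !S_INR; nra.
Qed.

End Poisson.

(** * Stirling's lower bound *)

(* An excess [f m = 1 + c] would be amplified to [f (2^j m) >= 1 + 2^j c]. *)
Lemma doubling_le1 (f : nat -> R) C m :
  (forall i, f i ^ 2 <= f (i + i)%nat) -> (forall i, f i ^ 2 <= C * INR i) -> f m <= 1.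
Proof.
move=> fD fC; case: (Rle_lt_dec (f m) 1) => // fm1; exfalso.
set c := f m - 1; have c0 : 0 < c by rewrite /c; lra.
have amp j : 1 + 2 ^ j * c <= f (expn 2 j * m)%nat.
  elim: j => [|j IHj]; first by rewrite expn0 mul1n /c /=; lra.
  have -> : (expn 2 j.+1 * m = expn 2 j * m + expn 2 j * m)%nat by rewrite expnS -mulnA mul2n addnn.
  apply: Rle_trans (fD _); have p0 : 0 < (2 ^ j)%R by apply: pow_lt; lra.
  apply: Rle_trans (_ : _ <= (1 + 2 ^ j * c) ^ 2) _; first by rewrite /=; nra.
  by apply: pow_incr; split=> //; nra.
have [j jP] : exists j, C * INR m / c ^ 2 < 2 ^ j.
  have [j jP] := Pow_x_infinity 2 (ltac:(rewrite Rabs_right; lra)) (C * INR m / c ^ 2 + 1).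
  exists j; have := jP j (le_n j); rewrite Rabs_right; first lra.
  by apply/Rle_ge/pow_le; lra.
have p0 : 0 < (2 ^ j)%R by apply: pow_lt; lra.
(* The left side grows like [4 ^ j], the right side only like [2 ^ j]. *)
have : (1 + 2 ^ j * c) ^ 2 <= C * (2 ^ j * INR m).
  apply: Rle_trans (_ : f (expn 2 j * m)%nat ^ 2 <= _).
    by apply: pow_incr; split=> //; nra.
  apply: Rle_trans (fC _) _; rewrite mult_INR; right; do 2 congr (_ * _).
  by elim: (j) => // i IHi; rewrite expnS mult_INR IHi /=; ring.
have c2 : 0 < c ^ 2 by apply: pow_lt.
have {jP} : C * INR m < 2 ^ j * c ^ 2.
  by move/Rlt_div_l: jP => /(_ c2).
by move=> H1 H2; nra.
Qed.

(* [pois (INR m) m 1 = exp (-m) m^m / m!], so this is the lower half of Stirling's formula. *)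
Lemma pois_mode_le m : pois (INR m) m 1 * sqrt (2 * PI * INR m) <= 1.
Proof.
have pi0 := PI_RGT_0.
apply: (doubling_le1 (f := fun m => pois (INR m) m 1 * sqrt (2 * PI * INR m)) (C := 2 * PI)) => i.
  have i0 := pos_INR i.
  have w := central_binom_ratio_le i.
  have p0 : 0 <= pois (INR (i + i)) (i + i) 1.
    case: (i) => [|j]; last by apply: pois_ge0; [apply: lt_0_INR; apply/ltP | lra].
    by rewrite /pois /= Rmult_0_l Ropp_0 exp_0; lra.
  (* The exponentials and powers match under doubling; only the central binomial ratio remains, and
     Wallis' inequality bounds it. *)
  have pp : pois (INR i) i 1 ^ 2 = pois (INR (i + i)) (i + i) 1 * central_binom_ratio i.
    rewrite /pois /central_binom_ratio plus_INR !Rmult_1_r Ropp_plus_distr exp_plus.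
    have -> : INR i + INR i = 2 * INR i by ring.
    rewrite pow_add Rpow_mult_distr.
    have -> : 4 = 2 * 2 by lra.
    rewrite Rpow_mult_distr.
    have f1 := INR_fact_neq_0 i; have f2 := INR_fact_neq_0 (i + i).
    have f3 : (2 ^ i)%R <> 0 by apply: pow_nonzero; lra.
    by rewrite /=; field.
  rewrite Rpow_mult_distr pow2_sqrt; last by nra.
  rewrite pp Rmult_assoc; apply: Rmult_le_compat_l => //.
  set b := central_binom_ratio i in w *.
  apply: Rle_trans (Rle_abs _) _; rewrite -sqrt_Rsqr_abs; apply: sqrt_le_1_alt.
  have c0 : 0 <= 4 * PI * INR i by nra.
  by have := Rmult_le_compat_l _ _ _ c0 w; rewrite /Rsqr plus_INR; lra.
have i0 := pos_INR i.
rewrite Rpow_mult_distr pow2_sqrt; last by nra.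
(* The linear growth bound only needs a Poisson weight to be at most 1. *)
rewrite -[X in _ <= X]Rmult_1_l; apply: Rmult_le_compat_r; first by nra.
have [->|ip] := posnP i.
  by rewrite /pois /= Rmult_0_l Ropp_0 exp_0; lra.
have i1 : 0 < INR i by apply: lt_0_INR; apply/ltP.
rewrite -[X in _ <= X](pow1 2); apply: pow_incr; split; first by apply: pois_ge0; lra.
have := poisQ_le1 i1 i.+1 Rle_0_1; have := poisQ_ge0 i1 i Rle_0_1 => /=; lra.
Qed.

(** The closed form leaves [1 - Q - p], the probability of exceeding [m], which is at least the next
    two weights [p1 + p2 = 2 L p / (L + 2)]. This yields the denominator [L + 2], that is [k + 1]
    for [m = k - 1]; the lower Stirling bound then controls [p]. *)
Lemma capped_mean_stirling m : (0 < m)%nat ->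
  1 - sqrt (INR m) / ((INR m.+1 + 1) * sqrt (2 * PI)) <= capped_mean (INR m) m.+1 1.
Proof.
move=> m0; have pi0 := PI_RGT_0.
have l1 : 1 <= INR m by apply: (INR_leq m0).
have a0 : 0 < INR m by lra.
have := capped_meanE a0 m 1; have := poisQ_le1 a0 m.+3 Rle_0_1.
have := poisS (INR m) m 1; have := poisS (INR m) m.+1 1; have := pois_mode_le m.
rewrite sqrt_mult; try lra.
rewrite !S_INR /=; set L := INR m in a0 l1 *; set p := pois L m 1.
set p1 := pois L m.+1 1; set p2 := pois L m.+2 1; set Q := poisQ L m 1.
set M := capped_mean L m 1 + _.
have := sqrt_lt_R0 (2 * PI) ltac:(lra).
have := sqrt_lt_R0 L a0; have := sqrt_sqrt L (Rlt_le _ _ a0).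
set S := sqrt L; set A := sqrt (2 * PI) => SS S0 A0 pAS E2 E1 Q1 EM.
have pL : p * L <= S / A.
  apply: (Rmult_le_reg_r A) => //; have -> : S / A * A = S by field; lra.
  have -> : p * L * A = p * (A * S) * S by rewrite -SS; ring.
  by rewrite -[X in _ <= X]Rmult_1_l; apply: Rmult_le_compat_r; lra.
have p1E : p1 = L * p / (L + 1) by apply: (Rmult_eq_reg_l (L + 1)); [rewrite E1; field|]; lra.
have p2E : p2 = L * p1 / (L + 2).
  apply: (Rmult_eq_reg_l (L + 2)); last lra.
  by transitivity ((L + 1 + 1) * p2); [ring | rewrite E2; field; lra].
have HM : L - L * (p * L / (L + 2)) <= L * M.
  have -> : L - L * (p * L / (L + 2)) = L + p1 + p2 - L * p by rewrite p2E p1E; field; lra.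
  by nra.
have HM' : 1 - p * L / (L + 2) <= M by apply: (Rmult_le_reg_l L) => //; lra.
apply: Rle_trans HM'; apply: Rplus_le_compat_l; apply: Ropp_le_contravar.
have -> : S / ((L + 1 + 1) * A) = S / A / (L + 2) by field; lra.
by apply: Rmult_le_compat_r => //; apply/Rlt_le/Rinv_0_lt_compat; lra.
Qed.

(** * The competitive ratio *)

Lemma Rceil_natP x : 0 <= x -> x <= INR (Rceil_nat x) < x + 1.
Proof.
move=> x0; have [u1 u2] := archimed x.
have INRE z : (0 <= z)%Z -> INR (Z.to_nat z) = IZR z.
  by move=> z0; rewrite INR_IZR_INZ Znat.Z2Nat.id.
rewrite /Rceil_nat; case: Req_EM_T => [E|E].
  by rewrite INRE ?minus_IZR ?E; [lra | apply: le_IZR; rewrite minus_IZR E].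
rewrite INRE; last by apply: le_IZR; lra.
by split; [lra | case: (Req_dec (IZR (up x) - x) 1); lra].
Qed.

Lemma exists_superset_card (T : finType) (A : {set T}) k :
  (#|A| <= k <= #|T|)%nat -> exists2 B : {set T}, A \subset B & #|B| = k.
Proof.
move=> /andP[Ak kT]; rewrite -(subnKC Ak) in kT *.
elim: (k - #|A|)%nat kT => [|m IHm] kT; first by exists A; rewrite ?addn0.
have [|B AB cardB] := IHm; first by apply: leq_trans kT; rewrite leq_add2l.
have /card_gt0P[x] : (0 < #|~: B|)%nat.
  by rewrite cardsCs setCK cardB subn_gt0 -addnS.
rewrite inE => xB; exists (x |: B); first by rewrite subsetU // AB orbT.
by rewrite cardsU1 xB cardB addnS.
Qed.

Lemma expected_alg1E (n : nat) (v : {set 'I_n} -> R) k t :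
  expected_alg1 v k t = mean (fun s => v (alg1 v k t s)).
Proof.
rewrite /expected_alg1 /mean foldrE big_map big_enum /=; congr (_ / _).
by apply: eq_bigl => s; rewrite inE.
Qed.

(** The factor of [p * v O] in the greedy bound for a sample fraction [p]. *)
Definition sample_bound k p := 1 - / (exp 1 * INR k) - p / exp 1.

(** One round of the induction in real numbers: [A], [B], [M] are capped means, [V], [V1], [V0] mean
    values, [a = k - 1]. Raising [g'] to the average [g] costs [I * (g - g') * M], which the surplus
    [h - g'] pays because [M <= x' + / I]. *)
Lemma backward_step a I W g g' h x' M A B V V0 V1 E :
  0 < a -> a + 1 <= I -> 0 <= W -> 0 <= g' <= g ->
  g * (x' + / I) = g' * x' + h * / I ->
  M <= (1 - a * / I) * A + a * / I * B + / I -> M <= x' + / I ->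
  (I + 1) * W * (g' * A) <= V1 -> (I + 1) * W * (g' * B) <= V0 ->
  (I + 1) * W * h <= E ->
  (I + 1 - (a + 1)) * V1 + (a + 1 - 1) * V0 + E <= (I + 1) * V ->
  I * W * (g * M) <= V.
Proof.
move=> a0 aI W0 [g'0 g'g] gx Ms Mx IH1 IH0 EE rec.
have I0 : 0 < I by lra.
have {}Ms : I * M <= (I - a) * A + a * B + 1.
  have := Rmult_le_compat_l I _ _ (Rlt_le _ _ I0) Ms.
  have -> : I * ((1 - a * / I) * A + a * / I * B + / I) = (I - a) * A + a * B + 1 by field; lra.
  by [].
have hg : h - g' = I * ((g - g') * (x' + / I)).
  by rewrite Rmult_minus_distr_r gx; field; lra.
have gM : I * ((g - g') * M) <= h - g'.
  by rewrite hg; apply: Rmult_le_compat_l; [|apply: Rmult_le_compat_l]; lra.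
have VW : W * (g' * ((I - a) * A + a * B) + h) <= V.
  apply: (Rmult_le_reg_l (I + 1)); first lra.
  apply: Rle_trans rec.
  have H1 : (I - a) * ((I + 1) * W * (g' * A)) <= (I - a) * V1 by apply: Rmult_le_compat_l; lra.
  have H0 : a * ((I + 1) * W * (g' * B)) <= a * V0 by apply: Rmult_le_compat_l; lra.
  by lra.
apply: Rle_trans VW; rewrite (Rmult_comm I) Rmult_assoc; apply: Rmult_le_compat_l => //.
have : g' * (I * M) <= g' * ((I - a) * A + a * B + 1) by apply: Rmult_le_compat_l.
by lra.
Qed.

(** * Backward induction over the rounds *)

Section Backward.
Variables (n : nat) (v : {set 'I_n} -> R) (O : {set 'I_n}) (m : nat).
Hypotheses (v_ge0 : nonneg_fn v) (v_mono : monotone_fn v) (v_sub : submodular_fn v).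
Hypotheses (m0 : (0 < m)%nat) (cardO : #|O| = m.+1).
Let k := m.+1.

Lemma mean_picks_ge0 r i : 0 <= mean_picks v k r i.
Proof. by rewrite -(mean_cst n 0); apply: mean_le => s; apply: v_ge0. Qed.

(* [x] is the remaining Poisson time and [g] the average of [sample_bound] over it.
   As [sample_bound] decreases with the round, [g] grows along the backward recursion,
   which makes [g * capped_mean] a subsolution of [mean_picks_rec]: Chebyshev's sum
   inequality in differential form. *)
Lemma mean_picks_ge i : (k <= i <= n)%nat ->
  exists x g, [/\ 0 <= x /\ ln (INR n) - ln (INR i) <= x,
    g * x = (1 - / (exp 1 * INR k)) * x - (INR n - INR i + x) / (exp 1 * INR n),
    0 <= g <= sample_bound k (INR i / INR n) &
    forall r, INR i / INR n * v O * (g * capped_mean (INR m) r x) <= mean_picks v k r i].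
Proof.
move=> /andP[ki]; move: ki.
have e2 : 2 <= exp 1 by have := exp_ineq1_le 1; lra.
have a1 : 1 <= INR m by apply: (INR_leq m0).
have kE : INR k = INR m + 1 by rewrite S_INR.
have ek1 : 4 <= exp 1 * INR k by nra.
have d4 : / (exp 1 * INR k) <= / 4 by apply: Rinv_le_contravar; lra.
have i2 : / exp 1 <= / 2 by apply: Rinv_le_contravar; lra.
have iE0 : 0 < / exp 1 by apply: Rinv_0_lt_compat; lra.
move dE: (n - i)%nat => d; elim: d i dE => [|d IHd] i dE ki iN.
  have {dE} iE : i = n by apply/eqP; rewrite eqn_leq iN -subn_eq0 dE.
  have N0 : 0 < INR n by apply: lt_0_INR; apply/ltP; rewrite -iE; apply: leq_trans ki.
  rewrite iE; exists 0, 0; split; [lra | by rewrite /Rdiv; ring | | move=> r].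
    by rewrite /sample_bound Rdiv_diag; lra.
  by rewrite Rmult_0_l Rmult_0_r; apply: mean_picks_ge0.
have i_n : (i < n)%nat by rewrite -subn_gt0 dE.
have [|||x' [g' [[x'0 lnx'] g'x' [g'0 g'h] IH]]] := IHd i.+1; rewrite ?subnS ?dE //.
  exact: leqW.
have I2 : 2 <= INR i by apply: (@INR_leq 2); apply: leq_trans ki.
have NI : INR i + 1 <= INR n by rewrite -S_INR; apply: INR_leq.
have IE : INR i.+1 = INR i + 1 by rewrite S_INR.
set I := INR i in I2 NI IE *; set N := INR n in NI lnx' g'x' IH g'h *.
set h := sample_bound k (INR i.+1 / N) in g'h *.
have c0 : 0 < / I by apply: Rinv_0_lt_compat; lra.
have x0 : 0 < x' + / I by lra.
have N0 : 0 < / N by apply: Rinv_0_lt_compat; lra.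
(* The new round contributes the bound [h] over a time interval of length [/ I]. *)
pose g := (g' * x' + h * / I) / (x' + / I).
have gx : g * (x' + / I) = g' * x' + h * / I. by rewrite /g /Rdiv Rmult_assoc Rinv_l; lra.
have gh : g <= h.
  apply: (Rmult_le_reg_r (x' + / I)) => //; rewrite gx Rmult_plus_distr_l.
  by apply/Rplus_le_compat_r/Rmult_le_compat_r; lra.
have g'g : g' <= g.
  apply: (Rmult_le_reg_r (x' + / I)) => //; rewrite gx Rmult_plus_distr_l.
  by apply/Rplus_le_compat_l/Rmult_le_compat_r; lra.
exists (x' + / I), g; split.
- split; first lra.
  (* The time [x] is a harmonic sum and so dominates the logarithm. *)
  have : ln (I + 1) <= ln I + / I; last by rewrite IE in lnx'; lra.
  rewrite -[/ I]ln_exp -ln_mult; [|lra|exact: exp_pos].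
  apply: ln_le; first lra.
  have := Rmult_le_compat_l I _ _ _ (exp_ineq1_le (/ I)).
  by rewrite Rmult_plus_distr_l Rinv_r; lra.
(* The accumulated term stays explicit since [(I + 1) / I = 1 + / I]. *)
- by rewrite gx g'x' /h /sample_bound IE; field; lra.
- split; first lra.
  apply: Rle_trans gh _; rewrite /h /sample_bound IE /Rdiv Rmult_plus_distr_r Rmult_1_l.
  by nra.
case=> [|r].
  by rewrite /capped_mean Rmult_0_r Rmult_0_r; apply: mean_picks_ge0.
have kI : (0 < k <= (Ordinal i_n).+1)%nat by apply: leqW.
have rec : (I + 1 - INR k) * mean_picks v k r.+1 i.+1 + (INR k - 1) * mean_picks v k r i.+1 +
    mean (fun s => v (greedy v k (prefix s i.+1))) <= (I + 1) * mean_picks v k r.+1 i.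
  by rewrite -IE; exact: (mean_picks_rec v_mono v_sub r kI).
have i1n : (0 < #|O| <= i.+1)%nat by rewrite cardO; apply: leqW.
have n1 : (1 < n)%nat by apply: (leq_trans _ i_n); rewrite ltnS (leq_trans _ ki).
have Gh : (I + 1) / N * h * v O <= mean (fun s => v (greedy v k (prefix s i.+1))).
  rewrite -IE /k -cardO.
  by have := mean_greedy_ge v_ge0 v_mono v_sub i1n n1 i_n; rewrite /h /k -cardO.
have := capped_mean_step (a := INR m) ltac:(lra) r x'0 (Rlt_le _ _ c0).
have := capped_mean_le (a := INR m) ltac:(lra) r.+1 (Rlt_le _ _ x0).
have := IH r; have := IH r.+1; move: rec Gh; rewrite IE kE.
have Im : INR m + 1 <= I by rewrite -kE; apply: INR_leq.
move: (mean_picks v k r.+1 i) (mean_picks v k r.+1 i.+1) (mean_picks v k r i.+1) => V V1 V0.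
move: (mean _) (capped_mean _ r.+1 (_ + _)) (capped_mean _ r.+1 x') (capped_mean _ r x') => E M A B.
have : 0 <= v O / N by apply: Rmult_le_pos; [exact: v_ge0 | lra].
have -> y : (I + 1) / N * y * v O = (I + 1) * (v O / N) * y by rewrite /Rdiv; ring.
have EW y z : y / N * v O * z = y * (v O / N) * z by rewrite /Rdiv; ring.
rewrite !EW.
move: (v O / N) => W W0 rec Gh IH1 IH0 Mx Ms.
by apply: (backward_step _ _ W0 (conj g'0 g'g) gx Ms Mx IH1 IH0 Gh rec); lra.
Qed.

End Backward.

(** With [u = / exp 1], [1 - 3u/2 + u^3/2 = (1-u)^2 (2+u)/2] and [exp 1 - 1 = (1-u)/u], so the
    denominator cancels. *)
Lemma ratio_thm6E k : (0 < k)%nat ->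
  ratio_thm6 k = / exp 1 * (1 - / exp 1 / INR k - / exp 1 * (1 + / exp 1) / 2) *
    (1 - sqrt (INR k - 1) / ((INR k + 1) * sqrt (2 * PI))).
Proof.
move=> k0; rewrite /ratio_thm6; congr (_ * _).
have e2 : 2 <= exp 1 by have := exp_ineq1_le 1; lra.
have k1 : 1 <= INR k by apply: (INR_leq k0).
by field; lra.
Qed.

(** Here [u = / exp 1]. The recursion yields [u * (1 - u/k' - u*(1-u))] up to [2/N]; this suffices
    because [1 - u <= (1+u)/2] when [u >= 1/3], that is [exp 1 <= 3]. *)
Lemma competitive_bound u k' N I g x F eps :
  / 3 <= u <= / 2 -> 2 <= k' -> 0 < N -> u * N - 1 <= I < u * N -> / N <= u ->
  1 <= x -> 0 <= g -> g * x = (1 - u / k') * x - (N - I + x) * u / N ->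
  0 <= F <= 1 -> 2 * / N <= eps ->
  u * (1 - u / k' - u * (1 + u) / 2) * F - eps <= I / N * (g * F).
Proof.
move=> u23 k2 N0 IN Nu x1 g0 gx F01 Neps.
set nu := / N in Nu Neps *; have nu0 : 0 < nu by apply: Rinv_0_lt_compat.
have nuN : nu * N = 1 by rewrite /nu Rinv_l; lra.
set d := u / k' in gx *.
have d01 : 0 <= d <= / 2.
  split; first by apply: Rdiv_le_0_compat; lra.
  by apply/Rle_div_l; lra.
pose A := 1 - d - u * (1 - u).
have NI : (N - I) * u * nu <= u * (1 - u) + u * nu.
  have -> : u * (1 - u) + u * nu = (N - u * N + 1) * u * nu.
    transitivity (u * (nu * N) - u * u * (nu * N) + u * nu); [rewrite nuN|]; ring.
  apply: Rmult_le_compat_r; first lra.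
  by apply: Rmult_le_compat_r; lra.
have gA : A - 2 * (u * nu) <= g.
  apply: (Rmult_le_reg_r x); first lra.
  rewrite gx /A /Rdiv -/nu.
  have NI0 : 0 <= u * (1 - u) + u * nu by apply: Rplus_le_le_0_compat; apply: Rmult_le_pos; lra.
  have : u * (1 - u) + u * nu <= (u * (1 - u) + u * nu) * x.
    by rewrite -[X in X <= _]Rmult_1_r; apply: Rmult_le_compat_l.
  by lra.
have Iu : u - nu <= I * nu.
  have -> : u - nu = (u * N - 1) * nu.
    by rewrite Rmult_minus_distr_r Rmult_assoc [N * _]Rmult_comm nuN; ring.
  by apply: Rmult_le_compat_r; lra.
have Ig : (u - nu) * (A - 2 * (u * nu)) <= I / N * g.
  apply: Rle_trans (_ : (u - nu) * g <= _); first by apply: Rmult_le_compat_l; lra.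
  by rewrite /Rdiv -/nu; apply: Rmult_le_compat_r; lra.
have uA : u * A - 2 * nu <= (u - nu) * (A - 2 * (u * nu)).
  have A1 : A <= 1 by rewrite /A; nra.
  have : 0 <= nu * (1 - A) + nu * (1 - 2 * (u * u)) + 2 * (u * (nu * nu)).
    apply: Rplus_le_le_0_compat; last by do ! apply: Rmult_le_pos; lra.
    by apply: Rplus_le_le_0_compat; apply: Rmult_le_pos; nra.
  by lra.
have uu : u * (1 - d - u * (1 + u) / 2) <= u * A.
  by apply: Rmult_le_compat_l; [lra | rewrite /A; nra].
rewrite -Rmult_assoc.
apply: Rle_trans (_ : (u * A - 2 * nu) * F <= _); last by apply: Rmult_le_compat_r; lra.
have : u * (1 - d - u * (1 + u) / 2) * F <= u * A * F by apply: Rmult_le_compat_r; lra.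
have : 2 * nu * F <= eps by nra.
by lra.
Qed.

Theorem mainTheorem6 (k : nat) (hk : (2 <= k)%nat) (eps : R) (heps : 0 < eps) :
  exists N : nat, forall n : nat, (N <= n)%nat ->
  forall v : {set 'I_n} -> R,
    nonneg_fn v -> monotone_fn v -> submodular_fn v ->
  forall OPT : {set 'I_n}, is_opt v k OPT ->
    (ratio_thm6 k - eps) * v OPT
      <= expected_alg1 v k (Rceil_nat (INR n / exp 1)).
Proof.
have e2 : 2 <= exp 1 by have := exp_ineq1_le 1; lra.
have e3 := exp_le_3.
have u23 : / 3 <= / exp 1 <= / 2 by split; apply: Rinv_le_contravar; lra.
(* As [exp 1 <= 3], [n >= 3 (k+1)] makes at least [k] rounds precede the threshold; [n >= 2/eps]
   absorbs the rounding loss. *)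
exists (maxn (3 * k.+1) (Z.to_nat (up (2 / eps)))) => n.
rewrite geq_max => /andP[n3 neps] v v_ge0 v_mono v_sub OPT [OPTk OPTmax].
have {n3} n3 : 3 * (INR k + 1) <= INR n.
  have -> : 3 = INR 3 by rewrite /=; lra.
  by rewrite -S_INR -mult_INR; apply: INR_leq.
have {neps} neps : 2 / eps <= INR n.
  apply: Rle_trans (INR_leq neps); have [up1 _] := archimed (2 / eps).
  have p0 : 0 < 2 / eps by apply: Rdiv_lt_0_compat; lra.
  rewrite INR_IZR_INZ Znat.Z2Nat.id; first lra.
  by apply: le_IZR; lra.
have k2 : 2 <= INR k by apply: (INR_leq hk).
have N0 : 0 < INR n by lra.
(* The optimum may have fewer than [k] items; padding it to exactly [k] keeps its value. *)
have [|O OPTO cardO] := @exists_superset_card _ OPT k.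
  by rewrite OPTk card_ord; apply/leP/INR_le; lra.
have vO : v OPT = v O.
  by apply: Rle_antisym; [exact: v_mono | apply: OPTmax; rewrite cardO].
have uN : INR n / exp 1 = / exp 1 * INR n by rewrite /Rdiv Rmult_comm.
have [] := @Rceil_natP (INR n / exp 1) ltac:(rewrite uN; nra).
set t := Rceil_nat _; rewrite uN => t1 t2.
have : (k < t)%nat by apply/leP/INR_le; rewrite S_INR; nra.
(* [i] is the number of rejected rounds, strictly less than [n / exp 1]. *)
move: t t1 t2 => [//|i] t1 t2 ki; rewrite ltnS in ki; rewrite S_INR in t1 t2.
have iN : (i <= n)%nat by apply/leP/INR_le; nra.
have -> : expected_alg1 v k i.+1 = mean_picks v k k i.
  by rewrite expected_alg1E; apply: eq_mean => s; rewrite alg1_picks.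
rewrite vO.
case: k => [|m] in hk k2 n3 OPTk OPTmax cardO ki *; first by [].
have kin : (m.+1 <= i <= n)%nat by rewrite ki.
have m0 : (0 < m)%nat by [].
have [x [g [[x0 lnx] gx [g0 gh] H]]] := mean_picks_ge v_ge0 v_mono v_sub m0 cardO kin.
apply: Rle_trans (H m.+1).
have I0 : 0 < INR i by have := INR_leq ki; lra.
(* Stopping the sample just below [n / exp 1] leaves at least one unit of logarithmic time, the
   argument at which the Stirling bound is stated. *)
have x1 : 1 <= x.
  have : ln (INR i) <= ln (/ exp 1 * INR n) by apply: ln_le; lra.
  by rewrite ln_mult ?ln_Rinv ?ln_exp; lra.
set F := 1 - sqrt (INR m.+1 - 1) / ((INR m.+1 + 1) * sqrt (2 * PI)).
have pi2 : 1 <= sqrt (2 * PI).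
  by rewrite -sqrt_1; apply: sqrt_le_1_alt; have := PI2_1; lra.
have F01 : 0 <= F <= 1.
  have s0 := sqrt_pos (INR m.+1 - 1).
  have den : 0 < (INR m.+1 + 1) * sqrt (2 * PI) by nra.
  have : 0 <= sqrt (INR m.+1 - 1) / ((INR m.+1 + 1) * sqrt (2 * PI)) <= 1.
    split; first exact: Rdiv_le_0_compat.
    apply/Rle_div_l => //; have : sqrt (INR m.+1 - 1) <= INR m.+1 + 1.
      have := sqrt_sqrt (INR m.+1 - 1) ltac:(lra); nra.
    by nra.
  by rewrite /F; lra.
have FM : F <= capped_mean (INR m) m.+1 x.
  apply: Rle_trans (capped_mean_incr (a := INR m) _ m.+1 Rle_0_1 x1).
    have := capped_mean_stirling m0; rewrite /F.
    by have -> : INR m.+1 - 1 = INR m by rewrite S_INR; ring.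
  by apply/lt_0_INR/ltP.
have Nu : / INR n <= / exp 1 by apply: Rinv_le_contravar; lra.
have Neps : 2 * / INR n <= eps.
  apply/Rle_div_l => //.
  by move/Rle_div_l: neps => /(_ heps); rewrite Rmult_comm.
apply: Rle_trans (_ : INR i / INR n * v O * (g * F) <= _).
  rewrite ratio_thm6E // -/F.
  have -> : INR i / INR n * v O * (g * F) = INR i / INR n * (g * F) * v O by ring.
  apply: Rmult_le_compat_r; first exact: v_ge0.
  apply: (competitive_bound (x := x)) => //; first by split; lra.
  by rewrite gx; field; lra.
apply: Rmult_le_compat_l; last exact: Rmult_le_compat_l.
by apply: Rmult_le_pos; [apply: Rdiv_le_0_compat; lra | exact: v_ge0].
Qed.
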